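(* Let $\rho_f,\rho_s,H_s,\alpha,\Delta t>0$, let $\beta,\psi$ be real parameters, and let $\{\mu_i\}_{i=1}^N$ and $\{\lambda_i\}_{i=1}^N$ be the (positive) eigenvalues of the discrete added mass operator and of the discrete Laplace operator on the interface, respectively. The explicit Robin-Neumann scheme with interface parameter $\alpha$ and time step $\Delta t$ is unstable if $$\rho_sH_s<\max_{i}\gamma_i,\qquad \gamma_i=\alpha\,\Delta t\,\frac{4\rho_f\mu_i+\Delta t^2\left(\beta+\psi\lambda_i\right)}{16\rho_f\mu_i+4\alpha\,\Delta t}.$$ Here unstable means that for at least one index $i$ the characteristic polynomial $\chi$ of the $i$-th modal difference equation of the scheme (given in the context) has a complex root of modulus strictly greater than $1$.
   Context: The scheme. A linear inviscid incompressible fluid (density $\rho_f$, velocity $\mathbf u$, pressure $p$) in a fixed rectangle $\Omega^f$ interacts through a side $\Sigma$ (of length $L$, axial coordinate $x$, outward normal $\mathbf n$) with a one-dimensional structure (density $\rho_s$, thickness $H_s$, elasticity parameters $\beta,\psi$, displacement $\eta$). With $u^n=(\mathbf u^n\cdot\mathbf n)|_\Sigma$, the explicit Robin-Neumann scheme with interface parameter $\alpha>0$ and time step $\Delta t$ does the following at each time $t^n=n\Delta t$: (1) solve the fluid problem $\rho_f\frac{\mathbf u^n-\mathbf u^{n-1}}{\Delta t}+\nabla p^n=0$, $\nabla\cdot\mathbf u^n=0$ in $\Omega^f$, with the Robin condition on $\Sigma$ $$-\alpha u^n+p^n=-\alpha\frac{\eta^n-\eta^{n-1}}{\Delta t}+\rho_sH_s\frac{\eta^n-2\eta^{n-1}+\eta^{n-2}}{\Delta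 t^2}+\beta\eta^n-\psi\frac{\partial^2\eta^n}{\partial x^2};$$ (2) solve the structure problem on $\Sigma$ $$\rho_sH_s\frac{\eta^{n+1}-2\eta^n+\eta^{n-1}}{\Delta t^2}+\beta\eta^n-\psi\frac{\partial^2\eta^n}{\partial x^2}=p^n.$$ Modal form. Let $\mathcal M$ be the added mass operator, i.e. $p^n=-\rho_f\mathcal M\big(\frac{u^n-u^{n-1}}{\Delta t}\big)$ on $\Sigma$ (null external pressure). The operators $\mathcal M$ and $-\partial_{xx}$ on $\Sigma$ share a basis of eigenfunctions $g_i$, with eigenvalues $\mu_i>0$ and $\lambda_i>0$ respectively; in the space-discretized setting there are finitely many, $i=1,\dots,N$. Eliminating $u^n$ and $p^n$ and expanding $\eta^n=\sum_i\eta_i^n g_i$, the scheme is equivalent to the difference equations, for each $i$, $$\frac{\rho_sH_s}{\Delta t^2}\Big(1+\frac{\rho_f\mu_i}{\alpha\Delta t}\Big)\eta_i^{n+1}+\Big(-\frac{2\rho_sH_s}{\Delta t^2}+\beta+\psi\lambda_i+\frac{\rho_f\mu_i}{\Delta t^2}-\frac{4\rho_sH_s\rho_f\mu_i}{\alpha\Delta t^3}\Big)\eta_i^n+\Big(\frac{\rho_sH_s}{\Delta t^2}-\frac{2\rho_f\mu_i}{\Delta t^2}+\frac{6\rho_sH_s\rho_f\mu_i}{\alpha\Delta t^3}\Big)\eta_i^{n-1}+\Big(\frac{\rho_f\mu_i}{\Delta t^2}-\frac{4\rho_sH_s\rho_f\mu_i}{\alpha\Delta t^3}\Big)\eta_i^{n-2}+\frac{\rho_sH_s\rho_f\mu_i}{\alpha\Delta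 t^3}\eta_i^{n-3}=0.$$ Multiplying by $\frac{\alpha\Delta t}{\rho_f\mu_i}$, the characteristic polynomial is $$\chi(y)=\frac{\rho_sH_s}{\Delta t^2}\Big(1+\frac{\alpha\Delta t}{\rho_f\mu_i}\Big)y^4+\Big(-\frac{2\alpha\rho_sH_s}{\rho_f\mu_i\Delta t}+\frac{\alpha\Delta t}{\rho_f\mu_i}(\beta+\psi\lambda_i)+\frac{\alpha}{\Delta t}-\frac{4\rho_sH_s}{\Delta t^2}\Big)y^3+\Big(\frac{\alpha\rho_sH_s}{\rho_f\mu_i\Delta t}-\frac{2\alpha}{\Delta t}+\frac{6\rho_sH_s}{\Delta t^2}\Big)y^2+\Big(\frac{\alpha}{\Delta t}-\frac{4\rho_sH_s}{\Delta t^2}\Big)y+\frac{\rho_sH_s}{\Delta t^2}.$$ *)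

(* Defs.v *)
From mathcomp Require Import all_boot all_order all_algebra.
From mathcomp Require Import reals ring.
From mathcomp Require Import complex.

Set Implicit Arguments.
Unset Strict Implicit.
Unset Printing Implicit Defensive.

Import Order.TTheory GRing.Theory Num.Theory.
Local Open Scope ring_scope.

(* The columns of G are a basis of eigenvectors of A; the eigenvalues are
   listed with multiplicity. *)
Definition eigenbasis (R : realType) (N : nat) (A G : 'M[R]_N)
    (mu : 'I_N -> R) : Prop :=
  G \in unitmx /\ forall i, A *m col i G = mu i *: col i G.

(* The explicit Robin-Neumann scheme reduced to the interface degrees of
   freedom.  M is the discrete added mass operator, which stands for the fluid
   problem with null external pressure; K is the discrete -d^2/dx^2.  The time
   index is an integer because the scheme at time 1 refers to eta (-1). *)
Definition robin_neumann_scheme (R : realType) (N : nat) (M K : 'M[R]_N)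
    (rhof rhos Hs alpha dt beta psi : R) (u p eta : int -> 'cV[R]_N) : Prop :=
  forall n : int, 1 <= n ->
  [/\ p n = - (rhof *: (M *m (dt^-1 *: (u n - u (n - 1))))),
      - (alpha *: u n) + p n
      = - ((alpha / dt) *: (eta n - eta (n - 1)))
        + (rhos * Hs / dt ^+ 2) *: (eta n - 2 *: eta (n - 1) + eta (n - 2))
        + beta *: eta n + psi *: (K *m eta n)
    & (rhos * Hs / dt ^+ 2) *: (eta (n + 1) - 2 *: eta n + eta (n - 1))
        + beta *: eta n + psi *: (K *m eta n)
      = p n].

(* Coefficients of the modal difference equation, mu and la being the
   eigenvalues of M and K: modal_coef k multiplies eta_i^(n-3+k). *)
Definition modal_coef (R : realType) (rhof rhos Hs alpha dt beta psi mu la : R)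
    (k : 'I_5) : R :=
  [:: rhos * Hs * rhof * mu / (alpha * dt ^+ 3);
      rhof * mu / dt ^+ 2 - 4 * rhos * Hs * rhof * mu / (alpha * dt ^+ 3);
      rhos * Hs / dt ^+ 2 - 2 * rhof * mu / dt ^+ 2
        + 6 * rhos * Hs * rhof * mu / (alpha * dt ^+ 3);
      - (2 * rhos * Hs / dt ^+ 2) + beta + psi * la + rhof * mu / dt ^+ 2
        - 4 * rhos * Hs * rhof * mu / (alpha * dt ^+ 3);
      rhos * Hs / dt ^+ 2 * (1 + rhof * mu / (alpha * dt))]`_k.

Lemma eigen_coord (R : realType) (N : nat) (A G : 'M[R]_N) (mu : 'I_N -> R)
    (hA : eigenbasis A G mu) (i : 'I_N) (v : 'cV[R]_N) :
  (invmx G *m (A *m v)) i 0 = mu i * (invmx G *m v) i 0.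
Proof.
case: hA => Gu AG.
have AGE : A *m G = G *m diag_mx (\row_j mu j).
  apply/matrixP => r c; rewrite mul_mx_diag [RHS]mxE [in RHS]mxE mulrC.
  have /matrixP/(_ r 0) := AG c; rewrite !mxE => <-.
  by apply: eq_bigr => j _; rewrite mxE.
have -> : A = G *m diag_mx (\row_j mu j) *m invmx G by rewrite -AGE mulmxK.
by rewrite -!mulmxA mulKmx // mul_diag_mx !mxE.
Qed.

Lemma modal_difference_equation (R : realType) (N : nat) (M K G : 'M[R]_N)
    (mu la : 'I_N -> R) (hM : eigenbasis M G mu) (hK : eigenbasis K G la)
    (rhof rhos Hs alpha dt beta psi : R) (halpha : 0 < alpha) (hdt : 0 < dt)
    (u p eta : int -> 'cV[R]_N)
    (hs : robin_neumann_scheme M K rhof rhos Hs alpha dt beta psi u p eta)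
    (i : 'I_N) (n : int) (hn : 2 <= n) :
  \sum_(k < 5) modal_coef rhof rhos Hs alpha dt beta psi (mu i) (la i) k
               * (invmx G *m eta (n - 3 + k%:Z)) i 0 = 0.
Proof.
pose c (v : 'cV[R]_N) : R := (invmx G *m v) i 0.
have cD v w : c (v + w) = c v + c w by rewrite /c mulmxDr mxE.
have cN v : c (- v) = - c v by rewrite /c mulmxN mxE.
have cZ a v : c (a *: v) = a * c v by rewrite /c -scalemxAr mxE.
have cM v : c (M *m v) = mu i * c v by exact: eigen_coord.
have cK v : c (K *m v) = la i * c v by exact: eigen_coord.
have h1n : 1 <= n by apply: le_trans hn.
have h1m : 1 <= n - 1 by rewrite lerBrDr.
have [/(congr1 c) + /(congr1 c) + /(congr1 c)] := hs n h1n.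
have [_ /(congr1 c) + /(congr1 c)] := hs (n - 1) h1m.
have -> : n - 1 - 1 = n - 2 by ring.
have -> : n - 1 - 2 = n - 3 by ring.
have -> : n - 1 + 1 = n by ring.
rewrite !(cD, cN, cZ, cM, cK) => e1 e2 e3 e4 e5.
rewrite !big_ord_recl big_ord0 /modal_coef /= -!/(c _) /bump /=.
have -> : n - 3 + 0%:Z = n - 3 by ring.
have -> : n - 3 + 1%:Z = n - 2 by ring.
have -> : n - 3 + (1 + 1)%N%:Z = n - 1 by ring.
have -> : n - 3 + (1 + (1 + 1))%N%:Z = n by ring.
have -> : n - 3 + (1 + (1 + (1 + 1)))%N%:Z = n + 1 by ring.
have a0 : alpha != 0 by rewrite gt_eqF.
have d0 : dt != 0 by rewrite gt_eqF.
rewrite -e2 in e1; rewrite -e5 in e3 e4.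
have u1 : c (u (n - 1)) = (c (eta (n - 1)) - c (eta (n - 2))) / dt
  + rhos * Hs / dt ^+ 2 / alpha * (c (eta n) - 3 * c (eta (n - 1))
    + 3 * c (eta (n - 2)) - c (eta (n - 3))).
  apply: (mulfI a0); apply/eqP; rewrite -subr_eq0; apply/eqP.
  move/eqP: e1; rewrite -subr_eq0 => /eqP e1.
  by apply: oppr_inj; rewrite oppr0 -[RHS]e1; field; rewrite a0 d0.
have u2 : c (u n) = (c (eta n) - c (eta (n - 1))) / dt
  + rhos * Hs / dt ^+ 2 / alpha * (c (eta (n + 1)) - 3 * c (eta n)
    + 3 * c (eta (n - 1)) - c (eta (n - 2))).
  apply: (mulfI a0); apply/eqP; rewrite -subr_eq0; apply/eqP.
  move/eqP: e4; rewrite -subr_eq0 => /eqP e4.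
  by apply: oppr_inj; rewrite oppr0 -[RHS]e4; field; rewrite a0 d0.
move/eqP: e3; rewrite u1 u2 -subr_eq0 => /eqP e3.
by rewrite -[RHS]e3; field; rewrite a0 d0.
Qed.

Definition chi (R : realType) (rhof rhos Hs alpha dt beta psi mu la : R) :
    {poly R} :=
  (rhos * Hs / dt ^+ 2 * (1 + alpha * dt / (rhof * mu))) *: 'X^4
  + (- (2 * alpha * rhos * Hs / (rhof * mu * dt))
     + alpha * dt / (rhof * mu) * (beta + psi * la)
     + alpha / dt - 4 * rhos * Hs / dt ^+ 2) *: 'X^3
  + (alpha * rhos * Hs / (rhof * mu * dt) - 2 * alpha / dt
     + 6 * rhos * Hs / dt ^+ 2) *: 'X^2
  + (alpha / dt - 4 * rhos * Hs / dt ^+ 2) *: 'X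
  + (rhos * Hs / dt ^+ 2)%:P.

Lemma chi_modal_coef (R : realType)
    (rhof rhos Hs alpha dt beta psi mu la : R) (hrhof : 0 < rhof)
    (halpha : 0 < alpha) (hdt : 0 < dt) (hmu : 0 < mu) :
  chi rhof rhos Hs alpha dt beta psi mu la
  = (alpha * dt / (rhof * mu)) *:
    \sum_(k < 5) modal_coef rhof rhos Hs alpha dt beta psi mu la k *: 'X^k.
Proof.
have f0 : rhof != 0 by rewrite gt_eqF.
have a0 : alpha != 0 by rewrite gt_eqF.
have d0 : dt != 0 by rewrite gt_eqF.
have m0 : mu != 0 by rewrite gt_eqF.
rewrite !big_ord_recl big_ord0 /= addr0 !scalerDr !scalerA /modal_coef /=.
rewrite /bump /= expr0 expr1 alg_polyC /chi.
rewrite [RHS]addrC; congr (_ + _); last first.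
  by congr _%:P; field; rewrite f0 a0 d0 m0.
rewrite [RHS]addrC; congr (_ + _); last first.
  by congr (_ *: _); field; rewrite f0 a0 d0 m0.
rewrite [RHS]addrC; congr (_ + _); last first.
  by congr (_ *: _); field; rewrite f0 a0 d0 m0.
by rewrite [RHS]addrC; congr (_ *: _ + _ *: _); field; rewrite f0 a0 d0 m0.
Qed.

(* The comparison takes place in R[i], whose order is partial; both sides are
   real. *)
Definition unstable (R : realType) (N : nat)
    (rhof rhos Hs alpha dt beta psi : R) (mu la : 'I_N -> R) : Prop :=
  exists (i : 'I_N) (z : R[i]),
    root (map_poly (real_complex R)
            (chi rhof rhos Hs alpha dt beta psi (mu i) (la i))) z
    /\ 1 < `|z|.

Definition gamma (R : realType) (rhof alpha dt beta psi mu la : R) : R :=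
  alpha * dt * ((4 * rhof * mu + dt ^+ 2 * (beta + psi * la))
                / (16 * rhof * mu + 4 * alpha * dt)).

(* Main.v *)
Require Import Defs.
From mathcomp Require Import all_boot all_order all_algebra.
From mathcomp Require Import reals.
From mathcomp Require Import complex.
From mathcomp Require Import polyrcf ring.

(** The instability is produced by a real root below -1.  The leading
    coefficient of [chi] is positive and its degree is even, so [chi] is
    positive near minus infinity; by the intermediate value theorem
    ([root_lt_of_even_size]) a root lies below -1 as soon as [chi] is
    negative at -1.  At -1 the coefficients of [chi] add up with alternating
    signs, and clearing the denominators shows that this value is negative
    exactly when rhos * Hs is below the threshold [gamma] of the mode
    ([chi_N1], [chi_N1_lt0]).  The powers of such a root are a solution of the
    modal difference equation that grows while changing sign at every time
    step. *)

Set Implicit Arguments.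
Unset Strict Implicit.
Unset Printing Implicit Defensive.

Import Order.TTheory GRing.Theory Num.Theory.
Local Open Scope ring_scope.

(** Below the Cauchy bound, where there are no roots, [p] keeps its sign at
    minus infinity, which for an even degree is that of the leading
    coefficient; the intermediate value theorem then applies between there
    and [x]. *)
Lemma root_lt_of_even_size (R : rcfType) (p : {poly R}) (x : R) :
    ~~ odd (size p).-1 -> 0 < lead_coef p -> p.[x] < 0 ->
  exists2 y, y < x & root p y.
Proof.
move=> even_p lc_gt0 px_lt0.
pose b := Num.min x (- cauchy_bound p).
have p_neq0 : p != 0 by rewrite -lead_coef_eq0 gt_eqF.
have pb_gt0 : 0 < p.[b].
  have := sgp_minftyP (le_cauchy_bound p_neq0).
  move/(_ b); rewrite in_itv /= ge_min lexx orbT => /(_ isT).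
  rewrite /sgp_minfty -signr_odd (negbTE even_p) expr0 mul1r (gtr0_sg lc_gt0).
  by move/eqP; rewrite sgr_cp0.
have b_le_x : b <= x by rewrite ge_min lexx.
have sign_change : (- p).[b] <= 0 <= (- p).[x].
  by rewrite !hornerN oppr_le0 oppr_ge0 !ltW.
have [y /andP [_ y_le_x]] := poly_ivt b_le_x sign_change.
rewrite rootN => y_root.
exists y; rewrite // lt_neqAle y_le_x andbT.
by apply: contraTneq y_root => ->; rewrite rootE lt_eqF.
Qed.

Lemma lt_bigmax_exists (R : realDomainType) (I : finType) (j : I) (F : I -> R)
    (m : R) :
  m < \big[Num.max/F j]_i F i -> exists i, m < F i.
Proof.
move=> m_lt; apply/existsP; apply: contraLR m_lt.
rewrite negb_exists => /forallP F_le.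
by rewrite -leNgt; apply/bigmax_leP; split=> [|i _]; rewrite leNgt.
Qed.

Section Mode.

Variables (R : realType) (rhof rhos Hs alpha dt beta psi mu la : R).
Hypotheses (rhof_gt0 : 0 < rhof) (rhos_gt0 : 0 < rhos) (Hs_gt0 : 0 < Hs).
Hypotheses (alpha_gt0 : 0 < alpha) (dt_gt0 : 0 < dt) (mu_gt0 : 0 < mu).

Let chi_mode := chi rhof rhos Hs alpha dt beta psi mu la.

Lemma chi_size_lead_coef :
  size chi_mode = 5 /\
  lead_coef chi_mode = rhos * Hs / dt ^+ 2 * (1 + alpha * dt / (rhof * mu)).
Proof.
rewrite /chi_mode /chi -!addrA.
set a := rhos * Hs / dt ^+ 2 * _; set q := (X in _ + X).
have a_gt0 : 0 < a.
  by rewrite mulr_gt0 ?addr_gt0 ?divr_gt0 ?mulr_gt0 ?exprn_gt0.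
have size_a : size (a *: 'X^4) = 5 by rewrite size_scale ?gt_eqF // size_polyXn.
have q_small : (size q < size (a *: 'X^4))%N.
  rewrite size_a ltnS /q.
  have deg c k : (k < 4)%N -> (size (c *: 'X^k : {poly R}) <= 4)%N.
    by move=> k4; rewrite (leq_trans (size_scale_leq _ _)) ?size_polyXn.
  apply: leq_trans (size_polyD _ _) _; rewrite geq_max deg //=.
  apply: leq_trans (size_polyD _ _) _; rewrite geq_max deg //=.
  apply: leq_trans (size_polyD _ _) _; rewrite geq_max (deg _ 1%N) //=.
  by rewrite (leq_trans (size_polyC_leq1 _)).
by rewrite size_polyDl // lead_coefDl // lead_coefZ lead_coefXn mulr1.
Qed.

(** This is where the threshold comes from: in the density rhos * Hs the value
    of [chi] at -1 is affine and increasing, and [gamma] is its zero. *)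
Lemma chi_N1 :
  chi_mode.[-1] = (16 * rhof * mu + 4 * alpha * dt) / (rhof * mu * dt ^+ 2)
    * (rhos * Hs - gamma rhof alpha dt beta psi mu la).
Proof.
have D_gt0 : 0 < 16 * rhof * mu + 4 * alpha * dt.
  by rewrite addr_gt0 ?mulr_gt0.
rewrite /chi_mode /chi /gamma !(hornerD, hornerZ, hornerXn, hornerX, hornerC).
by field; rewrite !gt_eqF.
Qed.

Lemma chi_N1_lt0 :
  (chi_mode.[-1] < 0) = (rhos * Hs < gamma rhof alpha dt beta psi mu la).
Proof.
rewrite chi_N1 pmulr_rlt0 ?subr_lt0 //.
by rewrite divr_gt0 ?addr_gt0 ?mulr_gt0 ?exprn_gt0.
Qed.

Lemma chi_root_ltN1 :
    rhos * Hs < gamma rhof alpha dt beta psi mu la ->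
  exists2 y, y < -1 & root chi_mode y.
Proof.
have [size_chi lc_chi] := chi_size_lead_coef.
rewrite -chi_N1_lt0; apply: root_lt_of_even_size; first by rewrite size_chi.
by rewrite lc_chi mulr_gt0 ?addr_gt0 ?divr_gt0 ?mulr_gt0 ?exprn_gt0.
Qed.

End Mode.

Theorem proposition1 (R : realType) (N : nat) (hN : (0 < N)%N)
    (M K G : 'M[R]_N) (mu la : 'I_N -> R)
    (hM : eigenbasis M G mu) (hK : eigenbasis K G la)
    (hmu : forall i, 0 < mu i) (hla : forall i, 0 < la i)
    (rhof rhos Hs alpha dt beta psi : R)
    (hrhof : 0 < rhof) (hrhos : 0 < rhos) (hHs : 0 < Hs)
    (halpha : 0 < alpha) (hdt : 0 < dt)
    (hgamma : rhos * Hs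
      < \big[Num.max/gamma rhof alpha dt beta psi
                       (mu (Ordinal hN)) (la (Ordinal hN))]_(i < N)
          gamma rhof alpha dt beta psi (mu i) (la i)) :
  unstable rhof rhos Hs alpha dt beta psi mu la.
Proof.
have [i gamma_i] := lt_bigmax_exists hgamma.
have [y y_lt y_root] := chi_root_ltN1 hrhof hrhos hHs halpha hdt (hmu i) gamma_i.
exists i, (real_complex R y); split.
  by rewrite fmorph_root.
rewrite normc_def /= expr0n addr0 sqrtr_sqr ltcR.
have y_lt0 : y < 0 by apply: lt_trans y_lt _; exact: ltrN10.
by rewrite (ltr0_norm y_lt0) ltrNr.
Qed.
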